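(* For each $n\ge1$ let $\mathbf{f}_n=(f_{n,0},f_{n,1},\dots)$ be a sequence of nonnegative integers with $f_{n,i}=0$ for $i\gg0$. The following are equivalent: (i) there exists a combinatorial $\mathrm{Inc}$-invariant chain of (finite) simplicial complexes $(\Delta_n)_{n\ge1}$ with $\mathbf{f}(\Delta_n)=\mathbf{f}_n$ for all $n\ge1$; (ii) for all $n,d\ge1$ one has $\partial_d(f_{n,d})\le f_{n,d-1}$ and $f_{n+1,d-1}\ge\mathrm{Inc}^{[d]}(f_{n,d-1})$.
   Context: $\mathbb{N}=\{1,2,3,\dots\}$. A (finite) simplicial complex is a finite collection of finite subsets of $\mathbb{N}$ closed under taking subsets. For $d\ge1$, $F_d(\Delta)$ is the set of $d$-element faces, viewed as a subset of $\binom{\mathbb{N}}{d}$ (the $d$-subsets of $\mathbb{N}$, written $\mathbf{u}=(u_1,\dots,u_d)$ with $u_1<\cdots<u_d$); $f_{d-1}(\Delta)=|F_d(\Delta)|$ and $\mathbf{f}(\Delta)=(f_0(\Delta),f_1(\Delta),\dots)$. $\mathrm{Inc}_1$ is the set of maps $\pi\colon\mathbb{N}\to\mathbb{N}$ with $\pi(j)<\pi(j+1)$ and $\pi(j)\le j+1$ for all $j$, acting by $\pi(\mathbf{u})=(\pi(u_1),\ldots,\pi(u_d))$; $\mathrm{Inc}(\mathcal{F})=\{\pi(\mathbf{u})\mid\mathbf{u}\in\mathcal{F},\pi\in\mathrm{Inc}_1\}$ and $\mathrm{Inc}(\Delta)=\bigcup_{d\ge1}\mathrm{Inc}(F_d(\Delta))$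 (together with the empty face). A chain $(\Delta_n)_{n\ge1}$ of simplicial complexes is combinatorial $\mathrm{Inc}$-invariant if $\mathrm{Inc}(\Delta_n)\subseteq\Delta_{n+1}$ for all $n\ge1$. Every positive integer $m$ has a unique $d$-binomial representation $m=\binom{a_d}{d}+\binom{a_{d-1}}{d-1}+\cdots+\binom{a_s}{s}$ with $a_d>a_{d-1}>\cdots>a_s\ge s\ge1$; with it, $\partial_d(m)=\binom{a_d}{d-1}+\binom{a_{d-1}}{d-2}+\cdots+\binom{a_s}{s-1}$ and $\mathrm{Inc}^{[d]}(m)=\binom{a_d+1}{d}+\binom{a_{d-1}+1}{d-1}+\cdots+\binom{a_s+1}{s}$; also $\partial_d(0)=\mathrm{Inc}^{[d]}(0)=0$.
   Formalization: In (ii) the first condition is corrected to ∂_{d+1}(f_{n,d}) ≤ f_{n,d-1} (Kruskal–Katona); with ∂_d as printed the equivalence fails, e.g. f_{n,0}=n, f_{n,1}=C(n+5,2), all other f_{n,i}=0. *)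

(* Defs.v *)
From mathcomp Require Import all_boot.
Set Implicit Arguments. Unset Strict Implicit. Unset Printing Implicit Defensive.

(* A face (finite subset of N = {1,2,...}) is encoded canonically as the
   strictly increasing list of its elements u = (u_1 < ... < u_d). *)
Definition is_face (u : seq nat) : bool := sorted ltn u && all (fun x => 0 < x) u.

(* A finite simplicial complex: a finite duplicate-free list of faces,
   closed under taking subsets (for strictly increasing lists, subsets
   correspond exactly to subsequences). *)
Definition is_complex (D : seq (seq nat)) : Prop :=
  [/\ uniq D,
      (forall u, u \in D -> is_face u) &
      (forall u v, u \in D -> subseq v u -> v \in D)].

Definition fvec (D : seq (seq nat)) (i : nat) : nat :=
  count (fun u => size u == i.+1) D.

Definition Inc1 (pi : nat -> nat) : Prop :=
  0 < pi 1 /\ forall j, 0 < j -> pi j < pi j.+1 /\ pi j <= j.+1.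

Definition inc_sub (D D' : seq (seq nat)) : Prop :=
  [::] \in D' /\ forall u pi, u \in D -> Inc1 pi -> map pi u \in D'.

(* a = [:: a_d; a_{d-1}; ...; a_s] is the d-binomial representation of m:
   m = sum_k C(a_{d-k}, d-k), a_d > ... > a_s >= s >= 1. *)
Definition binrep (d m : nat) (a : seq nat) : Prop :=
  [/\ 0 < size a <= d,
      sorted gtn a,
      d - size a + 1 <= last 0 a &
      m = \sum_(k < size a) 'C(nth 0 a k, d - k)].

Definition kk_bdry (d : nat) (a : seq nat) : nat :=
  \sum_(k < size a) 'C(nth 0 a k, (d - k).-1).

Definition kk_inc (d : nat) (a : seq nat) : nat :=
  \sum_(k < size a) 'C((nth 0 a k).+1, d - k).

(* Main.v *)
Require Import Defs.
From mathcomp Require Import all_boot zify.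
(** Let K_d be the optimal Kruskal-Katona shadow size, defined without binomials:
    if M is the least number with K_d(m - M) <= M, then K_d(m) = M + K_(d-1)(M).
    (M counts the sets containing the least vertex in a compressed family.)
    An induction using only this recursion gives
      K_d(m0 + m1) <= max(m1, K_d(m0)) + K_(d-1)(m1),
    and this single inequality yields both lower bounds.  Split a family by
    whether its sets contain the least vertex x; say m1 sets do and m0 do not.
    Among the shadow sets, those containing x come from the link of x, the others
    include both the link and the shadow of the rest.  Likewise an Inc-image
    starting with x comes from the link, and the others include all m0 + m1 full
    shifts and the Inc-image of the rest; since Inc^[d](m) = m + partial_d(m),
    the same inequality applies.  Frankl's argument bounds K_d below by the
    binomial formula.  Conversely, the first f_(n,d-1) of the d-sets in colex
    order, for all d, form the required complexes. *)

Set Implicit Arguments. Unset Strict Implicit. Unset Printing Implicit Defensive.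

(** * The optimal shadow size and its recursion *)

(* [link k m] is the least [x > 0] with [h (m - x) <= x], where
   [h y = link k y + k (link k y)]; [n] is fuel, and [link k 0 = 0]. *)
Fixpoint link_rec (k : nat -> nat) (n m : nat) : nat :=
  if n is n'.+1 then
    if m is m'.+1 then
      (find (fun x => let y := link_rec k n' (m' - x) in y + k y <= x.+1)
            (iota 0 m)).+1
    else 0
  else 0.

Definition link k m := link_rec k m m.

Fixpoint shadow_min (d m : nat) : nat :=
  if d is d'.+1 then link (shadow_min d') m + shadow_min d' (link (shadow_min d') m)
  else 0.

Lemma link_recS k n m : link_rec k n.+1 m.+1 =
  (find (fun x => link_rec k n (m - x) + k (link_rec k n (m - x)) <= x.+1)
        (iota 0 m.+1)).+1.
Proof. by []. Qed.

Lemma link_rec_fuel k n1 n2 m :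
  m <= n1 -> m <= n2 -> link_rec k n1 m = link_rec k n2 m.
Proof.
elim: n1 n2 m => [|n1 IH] [|n2] [|m] // m1 m2; rewrite !link_recS; congr S.
by apply: eq_find => x; rewrite (IH n2) //; lia.
Qed.

Section Link.
Variable k : nat -> nat.
Hypotheses (k0 : k 0 = 0) (k_homo : {homo k : x y / x <= y}).
Let h x := link k x + k (link k x).

Lemma link0 : link k 0 = 0. Proof. by []. Qed.

Lemma link_spec m : 0 < m ->
  [/\ 0 < link k m <= m, h (m - link k m) <= link k m &
      forall x, x < link k m -> x < h (m - x)].
Proof.
case: m => // m _.
set p := fun x => h (m - x) <= x.+1.
have linkE : link k m.+1 = (find p (iota 0 m.+1)).+1.
  rewrite /link link_recS; congr S; apply: (@eq_find _ _ p) => x.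
  by rewrite /p /h /link (@link_rec_fuel k m (m - x)) //; lia.
have hasp : has p (iota 0 m.+1).
  apply/hasP; exists m; first by rewrite mem_iota; lia.
  by rewrite /p subnn /h link0 k0.
have lt_find : find p (iota 0 m.+1) < m.+1.
  by rewrite -[X in _ < X](size_iota 0) -has_find.
have := nth_find 0 hasp; rewrite nth_iota // add0n {1}/p => pf.
split; rewrite linkE; [lia | by rewrite subSS |].
case=> [_|x lt_x]; first by rewrite subn0 /h linkE; lia.
have := before_find 0 lt_x; rewrite nth_iota ?add0n; last by lia.
by rewrite /p ltnNge subSS => ->.
Qed.

(** If the value dropped from [n.+1] to [n.+2], minimality would make the smaller value inadmissible
    at [n.+1], hence also at [n.+2], where the remainder is larger. *)
Lemma link_homo : {homo link k : x y / x <= y}.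
Proof.
suff homoS n : forall x y, y <= n -> x <= y -> link k x <= link k y.
  by move=> x y; apply: (homoS y).
elim: n => [|n IH] x y; first by case: x y => [|x] [].
case: (ltnP n y) => [lt_ny le_yn|le_yn _]; last exact: IH.
have {lt_ny le_yn} -> : y = n.+1 by lia.
case: (ltnP n x) => [lt_nx le_xn|le_xn _].
  by have -> : x = n.+1 by lia.
apply: leq_trans (IH x n (leqnn _) le_xn) _.
case: n => [|n] // in IH le_xn *.
have [b1 b2 _] := @link_spec n.+2 isT.
have [c1 _ c3] := @link_spec n.+1 isT.
rewrite leqNgt; apply/negP => lt_link.
have := c3 _ lt_link; suff : h (n.+1 - link k n.+2) <= h (n.+2 - link k n.+2) by lia.
by rewrite leq_add // ?k_homo // IH //; lia.
Qed.

End Link.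

Lemma shadow_min0 d : shadow_min d 0 = 0.
Proof. by elim: d. Qed.

Lemma shadow_min_homo d : {homo shadow_min d : x y / x <= y}.
Proof.
elim: d => [|d IH] x y le_xy //=.
have le_link := @link_homo _ (shadow_min0 d) IH _ _ le_xy.
by rewrite leq_add // IH.
Qed.

Lemma shadow_min_linkP d m : 0 < m ->
  let p := link (shadow_min d) m in
  [/\ 0 < p <= m, shadow_min d.+1 (m - p) <= p &
      forall x, x < p -> x < shadow_min d.+1 (m - x)].
Proof. exact: link_spec (shadow_min0 d) _. Qed.

(** Singletons have only the empty set in their shadow; a link larger than 1 would have to fail at
    1, against the induction. *)
Lemma shadow_min1 m : shadow_min 1 m <= 1.
Proof.
elim/ltn_ind: m => -[|m] IH //.
have [b1 b2 b3] := @shadow_min_linkP 0 m.+1 isT.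
have -> : shadow_min 1 m.+1 = link (shadow_min 0) m.+1 by rewrite /= addn0.
rewrite leqNgt; apply/negP => /b3.
by rewrite subSS subn0; have := IH m (ltnSn m); lia.
Qed.

Lemma shadow_min_split d m0 m1 :
  shadow_min d.+1 (m0 + m1) <= maxn m1 (shadow_min d.+1 m0) + shadow_min d m1.
Proof.
elim: d m0 m1 => [|d IHd] m0 m1.
  case: m1 => [|m1]; first by rewrite addn0 max0n leq_addr.
  by apply: leq_trans (shadow_min1 _) _; rewrite addn0; lia.
elim/ltn_ind: {m0 m1}(m0 + m1) {-2}m0 {-2}m1 (erefl (m0 + m1)) => m IH m0 m1 def_m.
case: (posnP m1) => [-> |m1_gt0]; first by rewrite addn0 max0n leq_addr.
have [|M1 M2 M3] := @shadow_min_linkP d.+1 (m0 + m1); first lia.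
set K := shadow_min d.+1; set M := link K (m0 + m1).
have SE x : shadow_min d.+2 x = link K x + K (link K x) by [].
rewrite -/K -/M in M1 M2 M3.
(* If [m1] covers the bound for [m0], then [m1] is an admissible link size for [m0 + m1]. *)
case: (leqP (shadow_min d.+2 m0) m1) => [le_m1|lt_m1].
  have le_M : M <= m1.
    by rewrite leqNgt; apply/negP => /M3; rewrite addnK; lia.
  rewrite SE -/M leq_add //; last exact: shadow_min_homo.
have m0_gt0 : 0 < m0 by case: (m0) lt_m1; rewrite ?shadow_min0.
have [P1 P2 P3] := @shadow_min_linkP d.+1 m0 m0_gt0.
have [p1 p2 p3] := @shadow_min_linkP d m1 m1_gt0.
rewrite -/K in P1 P2 P3; rewrite -/K in p2 p3.
set M0 := link K m0 in P1 P2 P3; set p := link _ m1 in p1 p2 p3.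
(* Otherwise the links add up: [M0 + p] is admissible for [m0 + m1], by induction on the remainder
   [(m0 - M0) + (m1 - p)]. *)
have lt_pq : m1 < M0 + K M0 by rewrite -SE.
have le_q : m1 - p <= M0.
  rewrite leqNgt; apply/negP => lt_q.
  have : K M0 <= K (m1 - p) by apply: shadow_min_homo; lia.
  by lia.
have le_p : p <= K M0.
  rewrite leqNgt; apply/negP => lt_p.
  have := p3 p.-1; suff : K (m1 - p.-1) <= K M0 by lia.
  by apply: shadow_min_homo; lia.
have le_M : M <= M0 + p.
  rewrite leqNgt; apply/negP => /M3.
  have -> : m0 + m1 - (M0 + p) = (m0 - M0) + (m1 - p) by lia.
  have /IH/(_ _ _ erefl) : (m0 - M0) + (m1 - p) < m by lia.
  by rewrite -/K; lia.
have leKM : K M <= maxn p (K M0) + shadow_min d p.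
  by apply: leq_trans (IHd _ _); apply: shadow_min_homo.
rewrite !SE -/M -/M0 -/K.
have -> : K m1 = p + shadow_min d p by [].
by lia.
Qed.

(** * Lower bounds for shadows and Inc-images *)

Definition starts x (u : seq nat) := if u is y :: _ then y == x else false.

Definition tails x (F : seq (seq nat)) := [seq behead u | u <- F & starts x u].

Lemma mem_tails x F v : (v \in tails x F) = (x :: v \in F).
Proof.
apply/mapP/idP => [[u]|xvF].
  by case: u => [|y u]; rewrite mem_filter //= => /andP[/eqP-> uF ->].
by exists (x :: v); rewrite // mem_filter /= eqxx.
Qed.

Lemma tails_uniq x F : uniq F -> uniq (tails x F).
Proof.
move=> uF; rewrite map_inj_in_uniq ?filter_uniq //.
move=> [|y u] [|z v]; rewrite !mem_filter //=.
by move=> /andP[/eqP-> _] /andP[/eqP-> _] ->.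
Qed.

Lemma size_tails x F :
  size F = size [seq u <- F | ~~ starts x u] + size (tails x F).
Proof. by rewrite size_map !size_filter addnC count_predC. Qed.

(** All entries lie strictly between [x] and [x + k]. Shrinking this range from the left drives the
    induction for both bounds. *)
Definition in_window e x k (u : seq nat) :=
  [/\ size u = e, path ltn x u & all (fun y => y < x + k) u].

Lemma window_tails e x k F :
  (forall u, u \in F -> in_window e.+1 x k.+1 u) ->
  forall u, u \in tails x.+1 F -> in_window e x.+1 k u.
Proof.
move=> wF u; rewrite mem_tails => /wF[/= [sz] /andP[_ pu] /andP[_ au]].
by split=> //; rewrite addSnnS.
Qed.

Lemma window_others e x k F :
  (forall u, u \in F -> in_window e.+1 x k.+1 u) ->
  forall u, u \in [seq u <- F | ~~ starts x.+1 u] -> in_window e.+1 x.+1 k u.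
Proof.
move=> wF u; rewrite mem_filter => /andP[st /wF[sz pu au]].
split=> //; last by rewrite addSnnS.
case: u sz pu st {au} => //= y u _ /andP[lt_xy ->] ne.
by rewrite andbT ltn_neqAle eq_sym ne.
Qed.

Lemma window0 e x F :
  (forall u, u \in F -> in_window e.+1 x 0 u) -> F = [::].
Proof.
case: F => // u F /(_ u (mem_head _ _)) [].
by case: u => //= y u _ /andP[lt_xy _] /andP[]; rewrite addn0 ltnNge ltnW.
Qed.

Lemma shadow_min_le_shadow e x k (F P : seq (seq nat)) :
  uniq F -> (forall u, u \in F -> in_window e x k u) ->
  (forall s y t, s ++ y :: t \in F -> s ++ t \in P) ->
  shadow_min e (size F) <= size P.
Proof.
elim: k e x F P => [|k IH] [|e] x F P uF wF dF //.
  by rewrite (window0 wF) shadow_min0.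
have st_tail u : u \in tails x.+1 F -> ~~ starts x.+1 u.
  rewrite mem_tails => /wF[_ /= /andP[_]].
  by case: u => //= y u /andP[lt_xy _] _; rewrite neq_ltn lt_xy orbT.
rewrite (size_tails x.+1 F) (size_tails x.+1 P).
apply: leq_trans (shadow_min_split _ _ _) _; apply: leq_add.
  rewrite geq_max; apply/andP; split.
    apply: uniq_leq_size (tails_uniq _ uF) _ => u uT.
    rewrite mem_filter st_tail //=.
    by apply: (dF [::] x.+1); rewrite -mem_tails.
  apply: IH (filter_uniq _ uF) (window_others wF) _ => s y t.
  move=> styF; have := window_others wF styF; case=> _ pu _.
  move: styF; rewrite !mem_filter => /andP[st /dF->]; rewrite andbT.
  case: s pu {st} => [|z s] /=; last by case/andP=> lt_xz; rewrite neq_ltn lt_xz orbT.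
  by case: t => //= z t /and3P[lt1 lt2 _]; rewrite neq_ltn (ltn_trans lt1 lt2) orbT.
apply: IH (tails_uniq _ uF) (window_tails wF) _ => s y t.
by rewrite !mem_tails => /(dF (x.+1 :: s)).
Qed.

(** A map in Inc_1 fixes an initial part of a face and adds one to the rest, so the splittings
    [s ++ t] run over all Inc-images. *)
Lemma shadow_min_le_inc e x k (F P : seq (seq nat)) :
  uniq F -> (forall u, u \in F -> in_window e x k u) ->
  (forall s t, s ++ t \in F -> s ++ map S t \in P) ->
  size F + shadow_min e (size F) <= size P.
Proof.
have sub0 (F' P' : seq (seq nat)) : uniq F' ->
    (forall s t, s ++ t \in F' -> s ++ map S t \in P') -> size F' <= size P'.
  move=> uF' iF'; apply: uniq_leq_size => // u uF.
  by have := iF' u [::]; rewrite !cats0; apply.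
elim: k e x F P => [|k IH] [|e] x F P uF wF dF; rewrite ?addn0; try exact: sub0.
  by rewrite (window0 wF) shadow_min0.
set F0 := [seq u <- F | ~~ starts x.+1 u]; set F1 := tails x.+1 F.
have sF : size F = size F0 + size F1 := size_tails _ _.
have le1 : size F1 + shadow_min e (size F1) <= size (tails x.+1 P).
  apply: IH (tails_uniq _ uF) (window_tails wF) _ => s t.
  by rewrite !mem_tails => /(dF (x.+1 :: s)).
set P0 := [seq u <- P | ~~ starts x.+1 u].
have le2 : size F0 + shadow_min e.+1 (size F0) <= size P0.
  apply: IH (filter_uniq _ uF) (window_others wF) _ => s t stF.
  have [_ pu _] := window_others wF stF.
  move: stF; rewrite !mem_filter => /andP[_ /dF->]; rewrite andbT.
  case: s pu => [|z s] /=; last by case/andP=> lt_xz; rewrite neq_ltn lt_xz orbT.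
  by case: t => //= z t /andP[lt1 _]; lia.
have le3 : size F <= size P0.
  rewrite -(size_map (map S)); apply: uniq_leq_size.
    by rewrite map_inj_uniq //; apply: inj_map => ? ? [].
  move=> _ /mapP[u uF' ->]; rewrite mem_filter (dF [::] u) // andbT.
  have [_ + _] := wF u uF'; case: u {uF'} => //= y u /andP[lt_xy _].
  by lia.
(* [le2] and [le3] together bound [size P0] below by [size F0 + maxn (size F1) (shadow_min e.+1
   (size F0))]. *)
have := shadow_min_split e (size F0) (size F1).
by rewrite (size_tails x.+1 P) -/P0 sF; lia.
Qed.

(** * Binomial sums along decreasing sequences *)

(* For a strictly decreasing [c] of size [d], [binsum d c] is the colex rank of
   the set [{x + 1 | x in c}], and [bdsum d c - 1] is the rank of that set with
   its least element removed. *)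
Fixpoint binsum (d : nat) (a : seq nat) : nat :=
  if a is x :: a' then 'C(x, d) + binsum d.-1 a' else 0.

Fixpoint bdsum (d : nat) (a : seq nat) : nat :=
  if a is x :: a' then 'C(x, d.-1) + bdsum d.-1 a' else 0.

Lemma binsumE d a : \sum_(k < size a) 'C(nth 0 a k, d - k) = binsum d a.
Proof.
elim: a d => [|x a IH] d; rewrite ?big_ord0 // big_ord_recl /= subn0 -IH.
by congr (_ + _); apply: eq_bigr => i _; case: d => [|d] /=; rewrite ?sub0n ?subSS.
Qed.

Lemma kk_bdryE d a : kk_bdry d a = bdsum d a.
Proof.
rewrite /kk_bdry.
elim: a d => [|x a IH] d; rewrite ?big_ord0 // big_ord_recl /= subn0 -IH.
by congr (_ + _); apply: eq_bigr => i _; case: d => [|d] /=; rewrite ?sub0n ?subSS.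
Qed.

(** Pascal's rule in each term; [size a <= d] keeps the lower indices positive. *)
Lemma kk_incE d a : size a <= d -> kk_inc d a = binsum d a + bdsum d a.
Proof.
move=> le_ad; rewrite -binsumE -kk_bdryE /kk_inc /kk_bdry -big_split /=.
apply: eq_bigr => i _; have := ltn_ord i.
by move=> lt_i; have -> : d - i = (d - i).-1.+1; [lia | rewrite binS].
Qed.

(** The [d]-subsets of {1, ..., x} are the first ['C(x, d)] sets in colex order. *)
Lemma binsum_ltn x d c : size c = d -> path gtn x c -> binsum d c < 'C(x, d).
Proof.
elim: c x d => [|y c IH] x [|d] //=; first by rewrite bin0.
move=> [sz] /andP[lt_yx /(IH _ _ sz)].
have := leq_bin2l d.+1 lt_yx; rewrite binS; lia.
Qed.

Lemma binsum_leq x d a : size a <= d -> path gtn x a -> binsum d a <= 'C(x, d).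
Proof.
elim: a x d => [|y a IH] x [|d] //= sz /andP[lt_yx /(IH _ _ sz)].
have := leq_bin2l d.+1 lt_yx; rewrite binS; lia.
Qed.

Lemma bdsum_leq x d a : size a <= d -> path gtn x a -> bdsum d a <= 'C(x, d.-1).
Proof.
elim: a x d => [|y a IH] x [|d] //= sz /andP[lt_yx /(IH _ _ sz)].
case: d sz => [|d] sz; first by case: a {IH} sz => //=; rewrite !bin0.
have := leq_bin2l d.+1 lt_yx; rewrite binS /=; lia.
Qed.

Lemma leq_size_head x c : path gtn x c -> size c <= x.
Proof. by elim: c x => //= y c IH x /andP[lt_yx /IH]; lia. Qed.

(** * Frankl's comparison with the binomial formula *)

(* Frankl's split of the rank: [C(x, i) = C(x - 1, i - 1) + C(x - 1, i)]. The maximum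
   in [rest_seq] keeps the sequence strictly decreasing once entries reach their
   minimal value, without changing the binomial coefficients. *)
Fixpoint link_seq (c : seq nat) : seq nat :=
  if c is x :: c' then if c' is [::] then [::] else x.-1 :: link_seq c' else [::].

Fixpoint rest_seq (c : seq nat) : seq nat :=
  if c is x :: c' then maxn x.-1 (size c') :: rest_seq c' else [::].

Lemma size_link_seq c : size (link_seq c) = (size c).-1.
Proof. by elim: c => //= x [|y c] //= ->. Qed.

Lemma size_rest_seq c : size (rest_seq c) = size c.
Proof. by elim: c => //= x c ->. Qed.

Lemma path_link_seq x c : path gtn x c -> path gtn x.-1 (link_seq c).
Proof.
elim: c x => //= y [|z c] IH x //= /and3P[lt_yx lt_zy pc].
by rewrite IH /= ?lt_zy ?andbT; lia.
Qed.

Lemma path_rest_seq x c : path gtn x c -> path gtn (maxn x.-1 (size c)) (rest_seq c).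
Proof.
by elim: c x => //= y c IH x /andP[lt_yx /IH ->]; rewrite andbT; lia.
Qed.

Lemma sorted_link_seq c : sorted gtn c -> sorted gtn (link_seq c).
Proof. by case: c => //= x [|y c] //= /(@path_link_seq x (y :: c)). Qed.

Lemma sorted_rest_seq c : sorted gtn c -> sorted gtn (rest_seq c).
Proof. by case: c => //= x c /path_rest_seq. Qed.

(** Pascal's rule splits every term of [bdsum] except the last, ['C(_, 0)], which gives the extra
    one. *)
Lemma link_seq_bdsum c : c != [::] -> sorted gtn c ->
  (binsum (size c).-1 (link_seq c)).+1 + bdsum (size c).-1 (link_seq c)
    = bdsum (size c) c.
Proof.
elim: c => [|x [|y c] IH] // _; first by rewrite /= bin0.
move=> /= /andP[lt_yx py]; have /= <- := IH isT py.
by case: x lt_yx => //= x _; rewrite binS; lia.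
Qed.

Lemma binsum_link_rest c : sorted gtn c ->
  binsum (size c).-1 (link_seq c) + binsum (size c) (rest_seq c)
    <= binsum (size c) c.
Proof.
elim: c => [|x [|y c] IH] //; first by rewrite /= !bin1; lia.
move=> pc; have := leq_size_head pc; move: pc.
move=> /= /andP[lt_yx py] le_cx; have /= := IH py.
case: x lt_yx le_cx => //= x _; rewrite ltnS => le_cx.
have -> : 'C(maxn x (size c).+1, (size c).+2) = 'C(x, (size c).+2).
  by case: (leqP x (size c).+1) => // le_x; rewrite !bin_small.
by rewrite binS; lia.
Qed.

(** The terms of [link_seq] are dominated one by one, and the last entry of [rest_seq] adds
    ['C(_, 0) = 1]. *)
Lemma binsum_link_ltn c : c != [::] ->
  binsum (size c).-1 (link_seq c) < bdsum (size c) (rest_seq c).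
Proof.
elim: c => [|x [|y c] IH] // _; first by rewrite /= bin0.
have /= := IH isT.
have := leq_bin2l (size c).+1 (leq_maxl x.-1 (size c).+1).
rewrite /=; lia.
Qed.

Lemma bdsum_le_shadow_min c m : sorted gtn c -> binsum (size c) c < m ->
  bdsum (size c) c <= shadow_min (size c) m.
Proof.
move sz: (size c) => d; elim: d c sz m => [|d IHd] c sz m sc.
  by rewrite (size0nil sz).
have c_n0 : c != [::] by rewrite -size_eq0 sz.
elim/ltn_ind: m c sz sc c_n0 => m IHm c sz sc c_n0 lt_m.
have [|p1 p2 _] := @shadow_min_linkP d m; first lia.
have -> : shadow_min d.+1 m =
  link (shadow_min d) m + shadow_min d (link (shadow_min d) m) by [].
set p := link _ m in p1 p2 *.
have := link_seq_bdsum c_n0 sc; rewrite sz /= => <-.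
(* A link above the rank of [link_seq c] suffices by induction on [d]. *)
case: (ltnP (binsum d (link_seq c)) p) => [lt_p|le_p].
  apply: leq_add => //; apply: IHd => //; first by rewrite size_link_seq sz.
  exact: sorted_link_seq.
(* A smaller link leaves [m - p] above the rank of [rest_seq c]; by induction on [m] its shadow
   exceeds [p], so [p] is inadmissible. *)
have := binsum_link_rest sc; have := binsum_link_ltn c_n0; rewrite sz /= => lt1 le2.
suff : bdsum d.+1 (rest_seq c) <= shadow_min d.+1 (m - p) by lia.
apply: IHm; [lia | by rewrite size_rest_seq | exact: sorted_rest_seq | | lia].
by rewrite -size_eq0 size_rest_seq sz.
Qed.

(** The witness is [x - 1, ..., x - d]; both equalities are hockey-stick identities. *)
Lemma staircase d x : 0 < d <= x -> exists c,
  [/\ size c = d, path gtn x c, (binsum d c).+1 = 'C(x, d) & bdsum d c = 'C(x, d.-1)].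
Proof.
elim: d x => // d IH [|x] //= le_dx.
case: d le_dx IH => [|d] le_dx IH.
  by exists [:: x]; rewrite /= !bin0 !bin1 ltnSn addn0.
have [|c [sz pc R /= B]] := IH x; first by lia.
by exists (x :: c); split; rewrite /= ?sz ?pc ?ltnSn // ?B !binS; lia.
Qed.

(* The colex predecessor of a binomial representation has [d] full terms: its last term
   [C(a_s, s)] unfolds into a staircase. *)
Lemma binrep_pred d x a : 0 < size a <= d -> path gtn x a ->
  d - size a + 1 <= last 0 a -> exists c,
  [/\ size c = d, path gtn x c, (binsum d c).+1 = binsum d a & bdsum d c = bdsum d a].
Proof.
elim: a d x => [|y [|z a] IH] [|d] x // sz pa la.
  have [|c [szc pc R B]] := @staircase d.+1 y; first by move: la; rewrite /=; lia.
  exists c; split; rewrite ?R ?B /= ?addn0 //.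
  move: pa; rewrite /= andbT => lt_yx.
  by case: c pc {szc R B} => //= w c /andP[lt_wy ->]; rewrite (ltn_trans lt_wy).
case/andP: pa => lt_yx pa.
have [||c [szc pc R B]] := IH d y _ pa; [move: sz => /=; lia | move: la => /=; lia |].
exists (y :: c); split; rewrite /= ?szc ?pc ?andbT ?B -?addnS ?R //.
Qed.

Lemma kk_bdry_le d m a : binrep d m a -> kk_bdry d a <= shadow_min d m.
Proof.
case=> sz sa la; rewrite binsumE kk_bdryE => ->.
have [|c [szc pc <- <-]] := @binrep_pred d (head 0 a).+1 a sz _ la.
  by case: a sa {sz la} => //= x a ->; rewrite ltnSn.
by rewrite -szc; apply: bdsum_le_shadow_min; rewrite ?szc // (path_sorted pc).
Qed.

Lemma kk_inc_le d m a : binrep d m a -> kk_inc d a <= m + shadow_min d m.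
Proof.
move=> ba; have := kk_bdry_le ba; case: ba => /andP[_ sz] _ _.
by rewrite binsumE kk_bdryE kk_incE // => <-; lia.
Qed.

(** * Deletion, shifting and enumeration in colex order *)

Lemma bdsum_le_binrep d c a : size c = d -> sorted gtn c ->
  size a <= d -> sorted gtn a -> binsum d c < binsum d a -> bdsum d c <= bdsum d a.
Proof.
elim: a d c => [|x a IH] [|d] [|y c] // [sz] pc sza pa /=.
(* The first differing entry decides: a smaller head of [c] caps its [bdsum] at ['C(x, d)], a larger
   one contradicts the order of the ranks. *)
case: (ltngtP y x) => [lt_yx|lt_xy|->].
- move=> _; apply: (@leq_trans 'C(x, d)); last exact: leq_addr.
  by apply: (@bdsum_leq x d.+1 (y :: c)); rewrite /= ?sz ?lt_yx.
- have := @binsum_leq y d.+1 (x :: a) sza; rewrite /= lt_xy => /(_ pa); lia.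
- by rewrite ltn_add2l leq_add2l; apply: IH => //; apply: path_sorted; eassumption.
Qed.

(** Removing the least element gives the subset of highest colex rank, [bdsum d.+1 c - 1]. *)
Lemma binsum_delete d c v : size c = d.+1 -> sorted gtn c ->
  subseq v c -> size v = d -> binsum d v < bdsum d.+1 c.
Proof.
elim: c d v => [|x c IH] d v //= [sz] pc.
have ltc := binsum_ltn sz pc.
case: v => [|y v] /=.
  by move=> _ d0; rewrite -d0 bin0.
case: eqP => [->|_] sv szv.
  case: d szv sz ltc => // d [szv] sz _ /=.
  by rewrite ltn_add2l; apply: IH => //; apply: path_sorted pc.
have eq_v : y :: v = c by apply/eqP; rewrite -(size_subseq_leqif sv) sz -szv.
by move: ltc; rewrite -eq_v /=; lia.
Qed.

(** The extreme case raises every entry by one, where Pascal's rule gives equality. *)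
Lemma binsum_map_le d (c : seq nat) (g : nat -> nat) : size c = d -> (forall x, x \in c -> g x <= x.+1) ->
  binsum d (map g c) <= binsum d c + bdsum d c.
Proof.
elim: c d => [|x c IH] [|d] //= [sz] lg.
have := leq_bin2l d.+1 (lg x (mem_head _ _)); rewrite binS.
have := IH d sz (fun y yc => lg y (mem_behead (s := x :: c) yc)); lia.
Qed.

Lemma leq_binS x d : x <= 'C(x + d, d.+1) + d.
Proof.
elim: x => // x IH; rewrite addSn binS.
by have : 0 < 'C(x + d, d); [rewrite bin_gt0; lia | lia].
Qed.

Lemma binsum_surj d j : exists c,
  [/\ size c = d.+1, sorted gtn c & binsum d.+1 c = j].
Proof.
elim: d j => [|d IH] j; first by exists [:: j]; rewrite /= bin1 addn0.
have exC : exists a, 'C(a, d.+2) <= j by exists 0.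
have ubC a : 'C(a, d.+2) <= j -> a <= j + d.+1.*2.
  move=> leC; case: (leqP a d.+1) => [|lt_a]; first by lia.
  by have := leq_binS (a - d.+1) d.+1; rewrite subnK; lia.
case: (ex_maxnP exC ubC) => a leC maxa.
have [c [sz sc Rc]] := IH (j - 'C(a, d.+2)).
exists (a :: c); split; [by rewrite /= sz | | by move: Rc => /=; lia].
(* The choice of [a] is greedy: a next entry [y >= a] would allow [a.+1] by Pascal's rule. *)
case: c sz sc Rc => //= y c [sz] -> Rc; rewrite andbT ltnNge; apply/negP => le_ay.
have := maxa a.+1; rewrite binS; have := leq_bin2l d.+1 le_ay; lia.
Qed.

Lemma binsum_inj d c c' : size c = d -> size c' = d -> sorted gtn c ->
  sorted gtn c' -> binsum d c = binsum d c' -> c = c'.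
Proof.
elim: c d c' => [|x c IH] [|d] [|y c'] //= [sz] [sz'] pc pc'.
have := binsum_ltn sz pc; have := binsum_ltn sz' pc'.
case: (ltngtP x y) => [lt|lt|->] l1 l2.
- by have := leq_bin2l d.+1 lt; rewrite binS; lia.
- by have := leq_bin2l d.+1 lt; rewrite binS; lia.
- by move=> /addnI/IH -> //; apply: path_sorted; eassumption.
Qed.

(** Trailing zero terms are cut off. Keeping the head lets the induction preserve strict
    decrease. *)
Lemma binrep_of_seq d c : size c = d -> sorted gtn c -> 0 < binsum d c ->
  exists a, binrep d (binsum d c) a /\ head 0 a = head 0 c.
Proof.
elim: c d => [|x c IH] [|d] // [sz] pc /=.
case: (posnP (binsum d c)) => [-> |R_gt0 _].
  rewrite addn0 bin_gt0 => le_dx; exists [:: x]; split=> //.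
  by split=> //=; [lia | rewrite big_ord1 subn0].
have [a [[sza sa la Ra] ha]] := IH d sz (path_sorted pc) R_gt0.
exists (x :: a); split=> //; split=> //.
- by case: a sza la {sa Ra ha} => //= y a; lia.
- case: c pc R_gt0 ha {IH sz Ra} => //= z c /andP[lt_zx _] _ hz.
  by case: a sa hz {sza la} => //= y a py hz; subst z; apply/andP.
- by case: a sza la {sa Ra ha} => //= y a; lia.
by rewrite binsumE /= Ra binsumE.
Qed.

(** * Necessity: face counts of complexes and chains *)

Lemma faces_window (F : seq (seq nat)) e :
  (forall u, u \in F -> is_face u /\ size u = e) ->
  exists k, forall u, u \in F -> in_window e 0 k u.
Proof.
move=> fF; exists (\max_(u <- F) \max_(x <- u) x).+1 => u uF.
have [/andP[su pu] sz] := fF u uF; split=> //.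
  by case: u su pu {uF sz} => //= x u -> /andP[->].
apply/allP => x xu; rewrite add0n ltnS.
apply: (@leq_trans (\max_(y <- u) y)).
  exact: (@leq_bigmax_seq _ _ xpredT id).
exact: (@leq_bigmax_seq _ _ xpredT (fun u : seq nat => \max_(y <- u) y)).
Qed.

Lemma shadow_min_fvec D i :
  is_complex D -> shadow_min i.+2 (fvec D i.+1) <= fvec D i.
Proof.
case=> uD fD sD; rewrite /fvec -!size_filter.
have [|k wk] := @faces_window [seq u <- D | size u == i.+2] i.+2.
  by move=> u; rewrite mem_filter => /andP[/eqP sz /fD].
apply: shadow_min_le_shadow (filter_uniq _ uD) wk _ => s y t.
rewrite !mem_filter !size_cat /= addnS => /andP[/eqP[->] uin].
rewrite eqxx; apply: sD uin _.
by rewrite cat_subseq // -cat1s suffix_subseq.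
Qed.

Lemma inc_suffix_mem D D' s t : (forall u, u \in D -> is_face u) ->
  inc_sub D D' -> s ++ t \in D -> s ++ map S t \in D'.
Proof.
move=> fD [_ iD] stD; have /andP[sst _] := fD _ stD.
case: t => [|y t] in stD sst *.
  have id1 : Inc1 id by split=> // j _; split.
  by have := iD _ _ stD id1; rewrite cats0 map_id.
pose pi j := if j < y then j else j.+1.
have pi1 : Inc1 pi.
  rewrite /Inc1 /pi; split=> [|j _]; first by case: ifP.
  by case: (ltnP j y); case: (ltnP j.+1 y); lia.
have := iD _ _ stD pi1; rewrite map_cat.
move: sst; rewrite sorted_pairwise; last exact: ltn_trans.
rewrite pairwise_cat => /and3P[/allrelP st _ /= /andP[/allP yt _]].
have -> : map pi s = s.
  rewrite -[RHS]map_id; apply/eq_in_map => x xs.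
  by rewrite /pi; have /= -> := st x y xs (mem_head _ _).
suff /= -> : map pi (y :: t) = map S (y :: t) by [].
apply/eq_in_map => x; rewrite inE /pi ltnNge.
by case: eqP => [->|_ /yt/ltnW->] //; rewrite leqnn.
Qed.

Lemma shadow_min_inc_fvec D D' i : is_complex D -> inc_sub D D' ->
  fvec D i + shadow_min i.+1 (fvec D i) <= fvec D' i.
Proof.
case=> uD fD sD iD; rewrite /fvec -!size_filter.
have [|k wk] := @faces_window [seq u <- D | size u == i.+1] i.+1.
  by move=> u; rewrite mem_filter => /andP[/eqP sz /fD].
apply: shadow_min_le_inc (filter_uniq _ uD) wk _ => s t.
rewrite !mem_filter !size_cat size_map => /andP[-> stD].
exact: inc_suffix_mem stD.
Qed.

(** * Sufficiency: complexes of initial colex segments *)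

Definition colex (u : seq nat) := map predn (rev u).
Definition colex_inv (c : seq nat) := rev (map S c).
Definition colex_rank u := binsum (size u) (colex u).

Lemma colexK c : colex (colex_inv c) = c.
Proof. by rewrite /colex /colex_inv revK -map_comp map_id. Qed.

Lemma colex_invK u : is_face u -> colex_inv (colex u) = u.
Proof.
move=> /andP[_ /allP pu]; rewrite /colex /colex_inv -map_comp.
rewrite -[RHS]revK; congr rev; rewrite -[RHS]map_id; apply/eq_in_map => x.
by rewrite mem_rev => /pu /= /prednK.
Qed.

Lemma size_colex u : size (colex u) = size u.
Proof. by rewrite size_map size_rev. Qed.

Lemma is_face_colex_inv c : is_face (colex_inv c) = sorted gtn c.
Proof.
rewrite /is_face /colex_inv rev_sorted sorted_map all_rev.
rewrite (_ : all _ _ = true) ?andbT; first exact: eq_sorted.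
by apply/allP => _ /mapP[x _ ->].
Qed.

Lemma sorted_colex u : is_face u -> sorted gtn (colex u).
Proof. by move=> fu; rewrite -is_face_colex_inv colex_invK. Qed.

Lemma subseq_colex u v : subseq v u -> subseq (colex v) (colex u).
Proof. by move=> sv; rewrite map_subseq // subseq_rev. Qed.

Lemma binsum_surjb d j : exists c : seq nat,
  [&& size c == d.+1, sorted gtn c & binsum d.+1 c == j].
Proof. by have [c [/eqP sz sc /eqP R]] := binsum_surj d j; exists c; apply/and3P. Qed.

Definition face_at d j := colex_inv (xchoose (binsum_surjb d j)).

Lemma face_atP d j :
  [/\ is_face (face_at d j), size (face_at d j) = d.+1 & colex_rank (face_at d j) = j].
Proof.
have /and3P[/eqP sz sc /eqP R] := xchooseP (binsum_surjb d j).
by rewrite /colex_rank is_face_colex_inv size_rev size_map sz colexK.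
Qed.

Lemma face_at_colex_rank u d :
  is_face u -> size u = d.+1 -> face_at d (colex_rank u) = u.
Proof.
move=> fu sz; have [ff szf rf] := face_atP d (colex_rank u).
rewrite -[LHS]colex_invK // -[RHS]colex_invK //; congr colex_inv.
apply: (@binsum_inj d.+1); rewrite ?size_colex ?sorted_colex //.
by move: rf; rewrite /colex_rank szf sz.
Qed.

Lemma face_at_inj d : injective (face_at d).
Proof.
move=> i j eq_ij; have [_ _ <-] := face_atP d i; rewrite eq_ij.
by have [] := face_atP d j.
Qed.

Definition colex_complex (N : nat) (g : nat -> nat) : seq (seq nat) :=
  undup ([::] :: flatten [seq [seq face_at d j | j <- iota 0 (g d)] | d <- iota 0 N]).

Section ColexComplex.
Variables (N : nat) (g : nat -> nat).
Hypothesis gN : forall i, N <= i -> g i = 0.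

Lemma mem_colex_complex u : (u \in colex_complex N g) =
  is_face u && ((u == [::]) || (colex_rank u < g (size u).-1)).
Proof.
rewrite mem_undup inE; case: eqP => [-> //|u_n0] /=.
apply/flatten_mapP/andP => [[d _ /mapP[j +]]|[fu lt_u]].
  rewrite mem_iota => lt_j ->; have [ff -> ->] := face_atP d j.
  by split=> //=; lia.
case: u u_n0 fu lt_u => // x u _ fu /= lt_u; exists (size u).
  by rewrite mem_iota /= ltnNge; apply: contraL lt_u => /gN ->.
apply/mapP; exists (colex_rank (x :: u)); first by rewrite mem_iota.
by rewrite face_at_colex_rank.
Qed.

Lemma fvec_colex_complex i : fvec (colex_complex N g) i = g i.
Proof.
rewrite /fvec -size_filter -[RHS](size_iota 0) -(size_map (face_at i)).
apply/perm_size/uniq_perm.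
- by rewrite filter_uniq ?undup_uniq.
- by rewrite map_inj_uniq ?iota_uniq //; apply: face_at_inj.
move=> u; rewrite mem_filter mem_colex_complex; apply/idP/mapP.
  case/and3P=> /eqP sz fu; case: eqP sz => [->|_] //= sz.
  rewrite sz => lt_u; exists (colex_rank u); first by rewrite mem_iota.
  by rewrite face_at_colex_rank.
case=> j; rewrite mem_iota => lt_j ->; have [-> sz ->] := face_atP i j.
by rewrite sz eqxx /=; case: eqP => //= _; lia.
Qed.

(** Vertices outside [v] are removed one at a time, so only codimension one matters, where
    [binsum_delete] bounds the new rank. *)
Lemma colex_complex_is_complex :
  (forall d c, size c = d.+2 -> sorted gtn c -> binsum d.+2 c < g d.+1 ->
     bdsum d.+2 c <= g d) -> is_complex (colex_complex N g).
Proof.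
move=> shadow; split; first exact: undup_uniq.
  by move=> u; rewrite mem_colex_complex => /andP[].
move=> u v; move: {-1}(size u - size v) (erefl (size u - size v)) => k.
elim: k u => [|k IH] u szk uD sv.
  suff -> : v = u by [].
  apply/eqP; rewrite -(size_subseq_leqif sv) eqn_leq size_subseq //=.
  by rewrite -subn_eq0 szk.
move: (uD); rewrite mem_colex_complex => /andP[fu rk].
have uu : uniq u by case/andP: fu => su _; apply: (sorted_uniq ltn_trans ltnn).
have [x xu xv] : exists2 x, x \in u & x \notin v.
  apply/hasP; rewrite has_predC; apply/negP => /allP uv.
  by have := uniq_leq_size uu uv; lia.
pose w := rem x u.
have wE : w = [seq y <- u | y != x] by rewrite /w rem_filter.
have sw : subseq w u by rewrite wE filter_subseq.
have szw : size w = (size u).-1 by rewrite size_rem.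
apply: IH (w) _ _ _; first by lia.
  rewrite mem_colex_complex; apply/andP; split.
    case/andP: fu => su /allP pu; apply/andP; split.
      exact: subseq_sorted ltn_trans _ _ sw su.
    by apply/allP => y /(mem_subseq sw)/pu.
  case: eqP => //= /eqP w_n0.
  have [d szu] : exists d, size u = d.+2.
    by exists (size u).-2; move: w_n0; rewrite -size_eq0 szw; lia.
  move: rk; case: eqP => [u0|_] /=; first by rewrite u0 in szu.
  rewrite /colex_rank szw szu /= => rk.
  apply: leq_trans (binsum_delete _ _ (subseq_colex sw) _) (shadow d _ _ _ rk);
    by rewrite ?size_colex ?sorted_colex // szw szu.
by rewrite wE subseq_filter sv andbT; apply/allP => y yv; apply: contraNneq xv => <-.
Qed.

End ColexComplex.

Lemma Inc1_face pi u : Inc1 pi -> is_face u -> is_face (map pi u).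
Proof.
move=> [pi1 piS] /andP[su /allP pu].
have piP j k : 0 < j -> j < k -> pi j < pi k.
  move=> j0; elim: k => // k IH; rewrite ltnS leq_eqVlt => /orP[/eqP <-|lt_jk].
    by case: (piS j j0).
  by apply: ltn_trans (IH lt_jk) _; case: (piS k); lia.
have pi_gt0 j : 0 < j -> 0 < pi j.
  by case: j => [|[|j]] // _; apply: leq_ltn_trans (piP 1 j.+2 isT isT).
apply/andP; split; last by apply/allP => _ /mapP[x /pu/pi_gt0 + ->].
rewrite sorted_map; apply: sub_in_sorted su; last exact/allP/pu.
by move=> x y x0 y0; apply: piP.
Qed.

(** Each entry rises by at most one, so [binsum_map_le] bounds the rank of the image. *)
Lemma colex_complex_inc_sub N g N' g' :
  (forall i, N <= i -> g i = 0) -> (forall i, N' <= i -> g' i = 0) ->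
  (forall d c, size c = d.+1 -> sorted gtn c -> binsum d.+1 c < g d ->
     binsum d.+1 c + bdsum d.+1 c < g' d) ->
  inc_sub (colex_complex N g) (colex_complex N' g').
Proof.
move=> gN gN' inc; split; first by rewrite mem_colex_complex.
move=> u pi; rewrite !mem_colex_complex // => /andP[fu rk] pi1.
rewrite Inc1_face //=; case: eqP => //= pu_n0.
case: u => // x u in fu rk pu_n0 *.
rewrite size_map; apply: (leq_ltn_trans _ (inc _ (colex (x :: u)) _ _ rk));
  rewrite ?size_colex ?sorted_colex //.
rewrite /colex_rank size_map.
have -> : colex (map pi (x :: u)) =
          map (fun y => (pi y.+1).-1) (colex (x :: u)).
  rewrite /colex -map_rev -!map_comp; apply/eq_in_map => y.
  by rewrite mem_rev; case/andP: fu => _ /allP pu /pu y0 /=; rewrite prednK.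
apply: binsum_map_le; first exact: size_colex.
by move=> y _; case: pi1 => _ /(_ y.+1 isT) []; lia.
Qed.

(** * Existence of representations and the equivalence *)

Lemma binrep_exists d m : 0 < m -> exists a, binrep d.+1 m a.
Proof.
have [c [sz sc <-]] := binsum_surj d m => m_gt0.
by have [a [ra _]] := binrep_of_seq sz sc m_gt0; exists a.
Qed.

Theorem theorem4p4 (f : nat -> nat -> nat)
  (hfin : forall n, 0 < n -> exists N, forall i, N <= i -> f n i = 0) :
  (exists D : nat -> seq (seq nat),
      (forall n, 0 < n -> is_complex (D n)) /\
      (forall n, 0 < n -> inc_sub (D n) (D n.+1)) /\
      (forall n i, 0 < n -> fvec (D n) i = f n i))
  <->
  (forall n d, 0 < n -> 0 < d ->
      (* partial_{d+1}(f_{n,d}) <= f_{n,d-1}   (partial(0) = 0) *)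
      (forall a, binrep d.+1 (f n d) a -> kk_bdry d.+1 a <= f n d.-1) /\
      (* f_{n+1,d-1} >= Inc^[d](f_{n,d-1})      (Inc^[d](0) = 0) *)
      (forall a, binrep d (f n d.-1) a -> kk_inc d a <= f n.+1 d.-1)).
Proof.
split=> [[D [cD [iD fD]]] n [|d] // n0 _ | bounds].
  split=> a ra.
    by apply: leq_trans (kk_bdry_le ra) _; rewrite -!fD //; apply/shadow_min_fvec/cD.
  apply: leq_trans (kk_inc_le ra) _; rewrite -!fD //.
  exact: shadow_min_inc_fvec (cD n n0) (iD n n0).
have shadow n d c : 0 < n -> size c = d.+2 -> sorted gtn c ->
    binsum d.+2 c < f n d.+1 -> bdsum d.+2 c <= f n d.
  move=> n0 sz sc lt_c; have [|a ra] := @binrep_exists d.+1 (f n d.+1); first lia.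
  have [/(_ a ra) + _] := bounds n d.+1 n0 isT; apply: leq_trans.
  move: ra => [/andP[_ sza] sa _]; rewrite binsumE kk_bdryE => fE.
  by apply: bdsum_le_binrep; rewrite -?fE.
have inc n d c : 0 < n -> size c = d.+1 -> sorted gtn c ->
    binsum d.+1 c < f n d -> binsum d.+1 c + bdsum d.+1 c < f n.+1 d.
  move=> n0 sz sc lt_c; have [|a ra] := @binrep_exists d (f n d); first lia.
  have [_ /(_ a ra) /=] := bounds n d.+1 n0 isT; apply: leq_trans.
  move: ra => [/andP[_ sza] sa _]; rewrite binsumE kk_incE // => fE.
  rewrite -addSn leq_add -?fE //.
  by apply: bdsum_le_binrep; rewrite -?fE.
have zero n : 0 < n -> exists N, f n N == 0.
  by move=> /hfin[N fN]; exists N; rewrite fN.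
(* The bound in [hfin] is not given as a function of [n]; the first zero entry is computable, and
   [shadow] propagates the zero upwards. *)
pose dim n := ex_minn (zero n.+1 isT).
have dimP n i : dim n <= i -> f n.+1 i = 0.
  rewrite /dim; case: ex_minnP => N /eqP fN _.
  elim: i => [|i IH]; first by case: N fN => // ->.
  rewrite leq_eqVlt => /orP[/eqP<- //|/IH fi0].
  case: (posnP (f n.+1 i.+1)) => // f_gt0.
  (* The set of rank 0 has a facet, so its [bdsum] is positive, which is impossible after a zero
     entry. *)
  have [c [sz sc Rc]] := binsum_surj i.+1 0.
  have := shadow n.+1 i c isT sz sc; rewrite Rc fi0 => /(_ f_gt0).
  have := binsum_delete sz sc (drop_subseq c 1).
  by rewrite size_drop sz subn1 => /(_ erefl); lia.
(* [dim] counts from 0, the chain from 1. *)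
exists (fun n => colex_complex (dim n.-1) (f n)); split; last split.
- case=> // n _; apply: colex_complex_is_complex; first exact: dimP.
  by move=> d c; apply: shadow.
- case=> // n _; apply: colex_complex_inc_sub; [exact: dimP | exact: dimP |].
  by move=> d c; apply: inc.
- by case=> // n i _; apply: fvec_colex_complex; apply: dimP.
Qed.
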